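(* If $G$ is a wheel-free graph on at least two vertices, then $G$ has at least two vertices of degree at most $3$.
   Context: Graphs are finite, simple and undirected. A graph $G$ is wheel-free if it contains no wheel as a subgraph, i.e. there is no cycle $C$ of $G$ (as a subgraph, not necessarily induced) and vertex $v\in V(G)\setminus V(C)$ such that $v$ has at least three neighbors in $V(C)$. *)

(* Defs.v *)
(* A finite simple graph is a symmetric irreflexive relation on a finType. *)
From mathcomp Require Import all_boot.

Set Implicit Arguments.
Unset Strict Implicit.
Unset Printing Implicit Defensive.

Section Graphs.

Variable (T : finType).
Implicit Types (e : rel T) (v : T) (c : seq T).

Definition neighbors e v : {set T} := [set w | e v w].

Definition degree e v : nat := #|neighbors e v|.

(* The size condition excludes the degenerate closed walks of length 0 and 2
   that path.ucycle accepts; chords are allowed. *)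
Definition graph_cycle e c : Prop := ucycle e c /\ 3 <= size c.

Definition is_wheel e c v : Prop :=
  [/\ graph_cycle e c, v \notin c & 3 <= #|neighbors e v :&: [set w in c]|].

Definition wheel_free e : Prop := ~ exists c v, is_wheel e c v.

End Graphs.

(* Main.v *)
(* Suppose at most one vertex has degree at most 3. Among the nonempty vertex
   sets S without low-degree vertices whose boundary lies in a pair {x, y} of
   distinct vertices joined outside S, take a minimal one; every proper nonempty
   subset of S then has at least 3 boundary vertices. A vertex off a cycle has at
   most 2 neighbours on it, so the part of S off a cycle through x, y (shortest
   inside S) has minimum degree at least 2 and contains a cycle. Hence there is a
   maximal 2-connected set L containing x, y, meeting S, and missing some cycle of
   J = S \ L; by maximality a connected subset of J avoiding a cycle of J has at
   most one neighbour in L.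
   If every cycle of J spans J, then J is an induced cycle; for d in J, a path of L
   between neighbours of the two neighbours of d, through a neighbour of d,
   completes a rim around the hub d.
   Otherwise take a cycle c of J and a connected M in J off c with M maximal.
   Rerouting c along ears shows that every vertex of c has a neighbour in M and
   that J = c + M. So c sees two vertices of L, M is a tree, and two leaves m1, m2
   of M each have two neighbours on c and a common neighbour l1 in L. Starting from
   a vertex d of c with a neighbour in L, follow c to the last vertex adjacent to
   m1 or m2, say to m2, then m2, l1, and return through L to d: this is a rim
   around m1. *)
From Stdlib Require Import Classical.
Require Import Defs.
From mathcomp Require Import all_boot.

Set Implicit Arguments.
Unset Strict Implicit.
Unset Printing Implicit Defensive.

(** * Extremal choice and ends of lists *)

Lemma ex_minimal (A : Type) (P : A -> Prop) (f : A -> nat) :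
  (exists a, P a) -> exists2 a, P a & forall b, P b -> f a <= f b.
Proof.
case=> a; elim/ltn_ind: {a}(f a) {-2}a (erefl (f a)) => n IHn a fa Pa.
have [[b [Pb ltb]]|nob] := classic (exists b, P b /\ f b < n).
  exact: IHn ltb b erefl Pb.
exists a => // b Pb; rewrite fa leqNgt; apply/negP => ltb.
by apply: nob; exists b.
Qed.

Lemma ex_maximal (A : Type) (P : A -> Prop) (f : A -> nat) (n : nat) :
    (forall a, P a -> f a <= n) -> (exists a, P a) ->
  exists2 a, P a & forall b, P b -> f b <= f a.
Proof.
move=> fn /(ex_minimal (fun a => n - f a)) [a Pa min_a].
by exists a => // b Pb; move: (min_a b Pb); rewrite leq_sub2lE // fn.
Qed.

Lemma last_rev (A : Type) (x : A) (s : seq A) : last x (rev s) = head x s.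
Proof. by case: s => // a s; rewrite rev_cons last_rcons. Qed.

Lemma head_rev (A : Type) (x : A) (s : seq A) : head x (rev s) = last x s.
Proof. by rewrite -last_rev revK. Qed.

(** * Connectivity inside induced subgraphs *)

Section Graph.

Variables (T : finType) (e : rel T).
Hypotheses (e_sym : symmetric e) (e_irr : irreflexive e).
Implicit Types (A B : {set T}) (u v w : T) (s c : seq T).

Definition boundary A : {set T} :=
  [set w | (w \notin A) && [exists v in A, e v w]].

Definition induced_rel A : rel T := [rel u v | [&& u \in A, v \in A & e u v]].

Definition conn A := {in A &, forall u v, connect (induced_rel A) u v}.

(* Single edges, single vertices and the empty set qualify. *)
Definition biconn A := conn A /\ forall z, conn (A :\ z).

Definition cycle_in A c := graph_cycle e c /\ {subset c <= A}.

Lemma boundaryP A w :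
  reflect (w \notin A /\ exists2 v, v \in A & e v w) (w \in boundary A).
Proof.
rewrite inE; apply: (iffP andP) => -[wA]; first by case/exists_inP => v; split=> //; exists v.
by case=> v vA vw; split=> //; apply/exists_inP; exists v.
Qed.

Lemma connect_closed (r : rel T) (P : T -> Prop) u v :
  (forall a b, P a -> r a b -> P b) -> P u -> connect r u v -> P v.
Proof.
move=> clos Pu /connectP[s rs ->]; elim: s u Pu rs => //= a s IHs u Pu.
by case/andP => ua; apply: IHs; apply: clos ua.
Qed.

Lemma induced_sym A : connect_sym (induced_rel A).
Proof.
by apply: sym_connect_sym => u v; rewrite /induced_rel /= [e v u]e_sym andbCA.
Qed.

Lemma connect_edge A u v :
  u \in A -> v \in A -> e u v -> connect (induced_rel A) u v.
Proof. by move=> uA vA uv; apply: connect1; rewrite /induced_rel /= uA vA. Qed.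

Lemma connect_induced_sub A B u v :
  A \subset B -> connect (induced_rel A) u v -> connect (induced_rel B) u v.
Proof.
move=> sAB; apply: connect_sub => a b /and3P[aA bA ab].
by apply: connect_edge => //; apply: (subsetP sAB).
Qed.

Lemma connect_induced_mem A u v :
  u \in A -> connect (induced_rel A) u v -> v \in A.
Proof.
by move=> uA; apply: (connect_closed (P := fun v => v \in A)) => // a b _ /and3P[].
Qed.

Lemma connect_path A u v : u \in A -> connect (induced_rel A) u v ->
  exists s, [/\ path e u s, uniq (u :: s), {subset u :: s <= A} & last u s = v].
Proof.
move=> uA /connectP[s0 ps ->]; case/shortenP: ps => s ps us _.
exists s; split=> //.
  by apply: sub_path ps => a b /and3P[].
elim: s u uA ps {us} => [|a s IHs] u uA /=; first by move=> _ b; rewrite inE => /eqP->.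
by case/andP=> /and3P[_ aA _] /(IHs a aA) sA b; rewrite inE => /predU1P[->|/sA].
Qed.

Lemma path_connect A u s : path e u s -> {subset u :: s <= A} ->
  {in u :: s, forall v, connect (induced_rel A) u v}.
Proof.
elim: s u => [|a s IHs] u /=; first by move=> _ _ v; rewrite inE => /eqP->.
case/andP=> ua ps sA v; rewrite inE => /predU1P[-> //|vs].
apply: (@connect_trans _ _ a).
  by apply: connect_edge => //; apply: sA; rewrite ?inE ?eqxx ?orbT.
by apply: IHs vs => // w ws; rewrite sA // inE ws orbT.
Qed.

Lemma conn_hub A h : {in A, forall v, connect (induced_rel A) h v} -> conn A.
Proof.
move=> hA u v uA vA; apply: connect_trans (hA v vA).
by rewrite induced_sym hA.
Qed.

Lemma conn_path u s : path e u s -> conn [set w in u :: s].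
Proof.
move=> ps; apply: (@conn_hub _ u) => v; rewrite in_set => vs.
by apply: (path_connect ps) vs => w; rewrite in_set.
Qed.

Lemma conn_sorted s : sorted e s -> conn [set w in s].
Proof. by case: s => [_ u v|u s]; [rewrite inE | apply: conn_path]. Qed.

Lemma conn_setU1 A u v : conn A -> u \in A -> e u v -> conn (v |: A).
Proof.
move=> cA uA uv; apply: (@conn_hub _ u) => w /setU1P[->|wA].
  by apply: connect_edge => //; rewrite !inE ?uA ?eqxx ?orbT.
by apply: connect_induced_sub (cA _ _ uA wA); apply: subsetUr.
Qed.

Lemma sorted_rev s : sorted e (rev s) = sorted e s.
Proof. by rewrite rev_sorted; apply: eq_sorted => u v; rewrite e_sym. Qed.

Lemma cycle_cat u s v t :
  cycle e (u :: s ++ v :: t) =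
    [&& path e u s, e (last u s) v, path e v t & e (last v t) u].
Proof. by rewrite /= rcons_cat cat_path /= rcons_path. Qed.

(** * 2-connected sets, paths through a given vertex, and ears *)

Lemma biconn_cycle c : graph_cycle e c -> biconn [set w in c].
Proof.
case=> /andP[cc uc] _; split.
  by case: c cc {uc} => [_ u v|u s]; rewrite ?inE // /= rcons_path => /andP[/conn_path].
move=> z; have [zc|zc] := boolP (z \in c); last first.
  rewrite (_ : _ :\ z = [set w in c]); last first.
    by apply/setP => w; rewrite !inE; case: eqP => [->|//]; rewrite (negPf zc).
  by case: c cc {uc zc} => [_ u v|u s]; rewrite ?inE // /= rcons_path => /andP[/conn_path].
have [i s rs] := rot_to zc.
rewrite (_ : _ :\ z = [set w in s]).
  have := cc; rewrite -(rot_cycle i) rs /= rcons_path => /andP[/path_sorted + _].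
  exact: conn_sorted.
apply/setP => w; rewrite !inE -(mem_rot i) rs inE.
move: uc; rewrite -(rot_uniq i) rs => /= /andP[zs _].
by case: eqP => [->|//]; rewrite (negPf zs).
Qed.

(** The default [u] of [head] and [last] is harmless, since [u \in s] makes [s] nonempty. Keeping
    the whole path in one list lets reversal exchange [p] and [q]. *)
Definition through A (p q u : T) : Prop :=
  exists s, [/\ sorted e s, uniq s, {subset s <= A}, u \in s & (head u s = p /\ last u s = q)].

Lemma throughC A p q u : through A p q u -> through A q p u.
Proof.
case=> s [es us sA sus [hs ls]]; exists (rev s); split.
- by rewrite sorted_rev.
- by rewrite rev_uniq.
- by move=> w; rewrite mem_rev => /sA.
- by rewrite mem_rev.
by rewrite head_rev last_rev.
Qed.

(** The stretch [s2] between [u] and [h] is exchanged for [w :: l], which is disjoint from the old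
    path, so the result stays simple. *)
Lemma through_detour A p q u w h s1 s2 s3 l :
    sorted e (s1 ++ u :: s2 ++ h :: s3) -> uniq (s1 ++ u :: s2 ++ h :: s3) ->
    {subset s1 ++ u :: s2 ++ h :: s3 <= A} -> {subset w :: l <= A} ->
    head u (s1 ++ [:: u]) = p -> last h s3 = q ->
    e u w -> path e w (rcons l h) -> uniq (w :: l) ->
    {in w :: l, forall v, v \notin s1 ++ u :: s2 ++ h :: s3} ->
  through A p q w.
Proof.
move=> es us sA lA hs ls uw pl ul disj.
exists (s1 ++ u :: w :: l ++ h :: s3); split.
- move: es; rewrite !sorted_cat_cons => /andP[-> /=].
  rewrite cat_path /= => /and3P[_ _ ps3].
  by move: pl; rewrite uw cat_path rcons_path /= => /andP[-> ->].
- have sub : subseq (s1 ++ u :: h :: s3) (s1 ++ u :: s2 ++ h :: s3).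
    by rewrite cat_subseq // -cat1s -[u :: _ ++ _]cat1s cat_subseq // suffix_subseq.
  have us' := subseq_uniq sub us.
  have -> : uniq (s1 ++ u :: w :: l ++ h :: s3) =
            uniq ((w :: l) ++ (s1 ++ u :: h :: s3)).
    apply: perm_uniq; rewrite -cat_cons -[u :: _ ++ _]cat1s catA.
    by rewrite perm_catCA -!catA.
  rewrite cat_uniq ul us' andbT /=; apply/hasPn => v /(mem_subseq sub) vs.
  by apply/negP => /disj; rewrite vs.
- move=> v; rewrite mem_cat inE -cat_cons mem_cat => vs.
  have [/lA //|vl] := boolP (v \in w :: l).
  move: vs; rewrite (negPf vl) /= => vs; apply: sA.
  by rewrite mem_cat inE mem_cat; case/or3P: vs => ->; rewrite ?orbT.
- by rewrite mem_cat !inE eqxx !orbT.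
split; first by case: (s1) hs.
by rewrite last_cat /= last_cat.
Qed.

(** If [w] is off the path, 2-connectedness leads from [w] back to the path while avoiding [u].
    Between [u] and the first vertex [h] reached, the path is replaced by the detour through [w]. *)
Lemma through_neighbor A p q u w : biconn A -> p != q -> w \in A -> e u w ->
  through A p q u -> through A p q w.
Proof.
move=> [_ cA] pq wA uw.
case=> s [es us sA sus [hs ls]].
have [ws|ws] := boolP (w \in s).
  by exists s; split=> //; case: s {es us sA sus} hs ls ws.
(* As [p != q], the path has a vertex other than [u], which serves as a target in [A :\ u]. *)
have [t ts tu] : exists2 t, t \in s & t != u.
  case: s {es us sA ws} hs ls sus => //= a s hs ls _; have [qu|qu] := eqVneq q u.
    by exists a; rewrite ?inE ?eqxx // hs -qu.
  by exists q => //; rewrite -ls mem_last.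
have wu : w != u by apply: contraNneq ws => ->.
have wAu : w \in A :\ u by rewrite !inE wu.
have /(connect_path wAu) [l [pl ul lA lt]] : connect (induced_rel (A :\ u)) w t.
  by apply: cA => //; rewrite !inE tu sA.
have hasl : has (mem s) l.
  apply/hasP; exists t => //; move: (mem_last w l); rewrite lt inE => /predU1P[tw|//].
  by rewrite tw (negPf ws) in ts.
case: (split_find_nth w hasl) pl ul lA => h l1 l2 hs' nl1 pl ul lA.
have {pl} pl : path e w (rcons l1 h) by move: pl; rewrite cat_path => /andP[].
have {ul} ul : uniq (w :: rcons l1 h).
  by move: ul; rewrite -cat_cons cat_uniq => /andP[].
have {}lA : {subset w :: rcons l1 h <= A :\ u}.
  by move=> b bl; apply: lA; rewrite -cat_cons mem_cat bl.
have hu : h != u by have := lA h; rewrite !inE mem_rcons mem_head orbT => /(_ isT)/andP[].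
have disj : {in w :: l1, forall v, v \notin s}.
  move=> v; rewrite inE => /predU1P[-> //|vl1].
  by move: nl1 => /hasPn/(_ v vl1).
have ul1 : uniq (w :: l1) by move: ul; rewrite /= mem_rcons inE rcons_uniq negb_or
    => /and3P[/andP[_ ->] _ ->].
have {}lA : {subset w :: l1 <= A}.
  move=> v vl; have := lA v; rewrite !inE mem_rcons inE orbCA -in_cons vl orbT => /(_ isT).
  by case/andP.
case/splitPr: sus => s1 s2 in es us sA hs ls ws ts hs' nl1 disj *.
move: hs'; rewrite inE mem_cat inE (negPf hu) /= => /orP[] hs'.
  (* When [h] precedes [u], the path is read backwards. *)
  apply: throughC; case/splitPr: hs' => s3 s4 in es us sA hs ls disj *.
  have revs : rev ((s3 ++ h :: s4) ++ u :: s2) = rev s2 ++ u :: rev s4 ++ h :: rev s3.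
    by rewrite !(rev_cat, rev_cons) -!cats1 -!catA.
  apply: (@through_detour _ _ _ u _ h (rev s2) (rev s4) (rev s3) l1) => //.
  - by rewrite -revs sorted_rev.
  - by rewrite -revs rev_uniq.
  - by move=> v; rewrite -revs mem_rev => /sA.
  - by rewrite cats1 -rev_cons head_rev; move: ls; rewrite last_cat.
  - by rewrite last_rev; move: hs; rewrite -catA; case: (s3).
  - by move=> v vl; rewrite -revs mem_rev disj.
case/splitPr: hs' => s3 s4 in es us sA hs ls disj *.
apply: (@through_detour _ _ _ u _ h s1 s3 s4 l1) => //.
- by case: (s1) hs.
- by move: ls; rewrite last_cat /= last_cat.
Qed.

(** The vertices of [A] on some [p]-[q] path include [p] and are closed under adjacency in [A], so
    by connectedness they are all of [A]. This consequence of Menger's theorem lets a rim pass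
    through a chosen vertex. *)
Lemma biconn_through A p q u :
    biconn A -> p \in A -> q \in A -> u \in A -> p != q ->
  through A p q u.
Proof.
move=> bA pA qA uA pq.
suff: u \in A /\ through A p q u by case.
have /(_ p u pA uA) := bA.1.
apply: (connect_closed (P := fun w => w \in A /\ through A p q w))
  => [a b [aA aT] /and3P[_ bB ab]|].
  by split=> //; apply: through_neighbor aT.
split=> //; have [s [ps us sA ls]] := connect_path pA (bA.1 p q pA qA).
by exists (p :: s); split=> //; apply: mem_head.
Qed.

Lemma path_rev_ear u s v : path e u (rcons s v) = path e v (rcons (rev s) u).
Proof.
have := sorted_rev (u :: rcons s v).
by rewrite rev_cons rev_rcons /= => ->.
Qed.

(** Deleting an ear vertex leaves two stubs, each hanging from its end in [A]; deleting any other
    vertex spares one end, from which the whole ear is reached. *)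
Lemma biconn_ear A s u v :
    biconn A -> u \in A -> v \in A -> u != v -> path e u (rcons s v) ->
    uniq s -> {in s, forall w, w \notin A} ->
  biconn (A :|: [set w in s]).
Proof.
move=> [cA dA] uA vA uv puv us sA; have pvu := puv; rewrite path_rev_ear in pvu.
move: puv pvu; rewrite !rcons_path => /andP[pu _] /andP[pv _].
split.
  apply: (@conn_hub _ u) => w; rewrite 2!inE => /orP[wA|ws].
    by apply: connect_induced_sub (cA _ _ uA wA); apply: subsetUl.
  apply: (path_connect pu); last by rewrite inE ws orbT.
  by move=> x; rewrite 2!inE in_set => /predU1P[->|->]; rewrite ?uA ?orbT.
move=> z; have [zs|zs] := boolP (z \in s).
  have sub : A \subset (A :|: [set w in s]) :\ z.
    apply/subsetP => w wA; rewrite 3!inE wA andbT.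
    by apply: contraTneq wA => ->; apply: sA.
  case/splitPr: zs => s1 s2 in pu pv us sA sub *.
  move: us; rewrite cat_uniq /= => /and3P[_ /norP[zs1 _] /andP[zs2 _]].
  move: pu pv; rewrite rev_cat rev_cons -cats1 -catA !cat_path.
  move=> /andP[pu _] /andP[pv _].
  have cu := connect_induced_sub sub (cA _ _ uA vA).
  apply: (@conn_hub _ u) => w; rewrite !inE mem_cat inE => /andP[].
  move=> /negPf-> /or3P[wA|ws1|/= ws2].
  - exact: connect_induced_sub (cA _ _ uA wA).
  - apply: (path_connect pu); last by rewrite inE ws1 orbT.
    move=> x; rewrite inE => /predU1P[->|xs]; first exact: (subsetP sub).
    rewrite !inE mem_cat xs !orbT andbT; apply: contraNneq zs1 => <- //.
  apply: connect_trans cu _.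
  apply: (path_connect pv); last by rewrite inE mem_rev ws2 orbT.
  move=> x; rewrite inE mem_rev => /predU1P[->|xs]; first exact: (subsetP sub).
  by rewrite !inE mem_cat inE xs !orbT andbT; apply: contraNneq zs2 => <-.
have sub : A :\ z \subset (A :|: [set w in s]) :\ z by apply: setSD; apply: subsetUl.
(* Reversing the ear exchanges its ends, at most one of which is [z]. *)
wlog uz : u v s uA vA uv pu pv us sA zs sub / u != z.
  move=> IH; have [uz|uz] := eqVneq u z; last exact: (IH u v s).
  move: IH => /(_ v u (rev s)); rewrite revK eq_sym rev_uniq mem_rev -uz.
  have -> : [set w in rev s] = [set w in s] by apply/setP=> w; rewrite !inE mem_rev.
  rewrite -uz in sub zs; apply=> //; rewrite 1?eq_sym //.
  by move=> w; rewrite mem_rev => /sA.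
have uAz : u \in A :\ z by rewrite !inE uz.
apply: (@conn_hub _ u) => w; rewrite !inE => /andP[wz]; case/orP => [wA|ws].
  by apply: connect_induced_sub sub _; apply: dA; rewrite // !inE wz.
apply: (path_connect pu); last by rewrite inE ws orbT.
move=> x; rewrite inE => /predU1P[->|xs]; first exact: (subsetP sub).
by rewrite !inE xs orbT andbT; apply: contraNneq zs => <-.
Qed.

(** * Acyclic sets and their leaves *)

Lemma acyclic_path_end A u s :
    ~ (exists c, cycle_in A c) -> path e u s -> uniq (u :: s) ->
    {subset u :: s <= A} -> (forall w, w \in A -> e u w -> w \in s) ->
  #|neighbors e u :&: A| <= 1.
Proof.
move=> noc ps us sA uN; rewrite leqNgt; apply/negP => /card_gt1P[w1 [w2 []]].
rewrite !inE => /andP[uw1 w1A] /andP[uw2 w2A] w12.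
case: s ps us sA uN => [|a s] ps us sA uN; first by have := uN _ w1A uw1.
(* One of the two neighbours [w1], [w2] is not the successor [a] of [u]; the path up to it closes to
   a cycle. *)
have [w ws uw] : exists2 w, w \in s & e u w.
  have [w1a|w1a] := eqVneq w1 a; [exists w2 => //|exists w1 => //].
    by have := uN _ w2A uw2; rewrite inE -w1a eq_sym (negPf w12).
  by have := uN _ w1A uw1; rewrite inE (negPf w1a).
case/splitPr: ws => s1 s2 in ps us sA {uN}.
apply: noc; exists (u :: a :: rcons s1 w); split.
  split; last by rewrite /= size_rcons.
  move: ps us; rewrite -cat_rcons -!cat_cons cat_path cat_uniq => /andP[ps _] /andP[us _].
  apply/andP; split=> //; rewrite [cycle _ _]rcons_path ps /= last_rcons.
  by rewrite e_sym.
by move=> b bs; apply: sA; rewrite -cat_rcons -!cat_cons mem_cat bs.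
Qed.

(** A longest path in [A] cannot be prolonged, so each end has all its neighbours in [A] on the path
    and hence at most one of them. The last clause allows for a path of a single vertex. *)
Lemma acyclic_ends A : A != set0 -> ~ (exists c, cycle_in A c) ->
  exists u v, [/\ u \in A, v \in A, #|neighbors e u :&: A| <= 1,
                  #|neighbors e v :&: A| <= 1 &
                  neighbors e u :&: A != set0 -> u != v].
Proof.
case/set0Pn => u0 u0A noc.
pose P s := [/\ sorted e s, uniq s & {subset s <= A}].
have [||s [es us sA] max_s] := @ex_maximal _ P size #|T|.
- by move=> s [_ /card_uniqP<- _]; apply: max_card.
- by exists [:: u0]; split=> // w; rewrite inE => /eqP->.
have P_end u s' : P (u :: s') -> size s <= size (u :: s') ->
    forall w, w \in A -> e u w -> w \in s'.
  move=> [es' us' sA'] ss w wA uw; apply: contraTT ss => ws; rewrite -ltnNge.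
  apply: (max_s (w :: u :: s')); split.
  - by rewrite /= e_sym uw.
  - rewrite cons_uniq us' andbT inE negb_or ws andbT.
    by apply: contraTneq uw => ->; rewrite e_irr.
  - by move=> x; rewrite inE => /predU1P[->|/sA'].
case: s => [|u s] in es us sA max_s P_end *.
  have := max_s [:: u0]; rewrite ltn0 => /(_ _)/notF; case; split=> // w.
  by rewrite inE => /eqP->.
have def_r : rev (u :: s) = last u s :: rev (belast u s) by rewrite lastI rev_rcons.
have Pr : P (last u s :: rev (belast u s)).
  rewrite -def_r; split; rewrite ?sorted_rev ?rev_uniq //.
  by move=> w; rewrite mem_rev => /sA.
exists u, (last u s); split.
- exact/sA/mem_head.
- exact/sA/mem_last.
- by apply: (acyclic_path_end noc es us sA); apply: P_end.
- case: (Pr) => es' us' sA'; apply: (acyclic_path_end noc es' us' sA').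
  by apply: P_end => //; rewrite -def_r size_rev.
case/set0Pn => w; rewrite !inE => /andP[uw wA].
have: w \in s by apply: P_end uw.
case: (s) us => // a s' /= /andP[us' _] _.
by apply/eqP => ul; move: us'; rewrite {1}ul mem_last.
Qed.

Lemma cycle_of_mindeg2 A : A != set0 ->
  {in A, forall u, 2 <= #|neighbors e u :&: A|} -> exists c, cycle_in A c.
Proof.
move=> A0 degA; apply: NNPP => noc.
have [u [v [uA _ + _ _]]] := acyclic_ends A0 noc.
by rewrite leqNgt degA.
Qed.

Lemma card_neighbors_cover A B u : neighbors e u \subset A :|: B ->
  degree e u <= #|neighbors e u :&: A| + #|neighbors e u :&: B|.
Proof.
move=> /setIidPl sub; rewrite /degree -{1}sub setIUr.
by rewrite cardsU leq_subr.
Qed.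

(** * Wheel-freeness as a bound on neighbours along a cycle *)

Hypothesis wf : wheel_free e.

Lemma wheel_free_le2 c v : graph_cycle e c -> v \notin c ->
  #|neighbors e v :&: [set w in c]| <= 2.
Proof.
move=> cc vc; rewrite leqNgt; apply/negP => vN.
by apply: wf; exists c, v.
Qed.

(** Three distinct spoke ends on [c] force length at least 3, so asking for [ucycle] is enough. *)
Lemma wheel_free_spokes c v w1 w2 w3 :
    ucycle e c -> v \notin c -> uniq [:: w1; w2; w3] ->
    w1 \in c -> w2 \in c -> w3 \in c -> e v w1 -> e v w2 -> e v w3 -> False.
Proof.
move=> cc vc u3 w1c w2c w3c vw1 vw2 vw3.
have sub : {subset [:: w1; w2; w3] <= neighbors e v :&: [set w in c]}.
  by move=> w; rewrite !inE => /or3P[]/eqP->; rewrite ?w1c ?w2c ?w3c ?vw1 ?vw2 ?vw3.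
have sz : 3 <= size c.
  by apply: (uniq_leq_size u3) => w /sub; rewrite !inE => /andP[].
have := wheel_free_le2 (conj cc sz) vc; rewrite leqNgt => /negP[].
have <- : #|[:: w1; w2; w3]| = 3 by rewrite (card_uniqP u3).
by apply: subset_leq_card; apply/subsetP.
Qed.

(** * Maximal 2-connected sets in a fragment *)

Section Fragment.

Variables (S : {set T}) (x y : T).
Hypothesis degS : {in S, forall v, 4 <= degree e v}.
Hypothesis boundaryS : boundary S \subset [set x; y].
Hypothesis boundary3 :
  forall A, A != set0 -> A \proper S -> 3 <= #|boundary A|.

(** With [x] and [y] in [L], edges leave [S :\: L] only into [L]; a vertex of [S] in [L] makes all
    subsets of [S :\: L] proper in [S]; the leftover cycle is what an ear added to [L] has to
    avoid. *)
Definition shell L := [/\ biconn L, x \in L, y \in L, L :&: S != set0 &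
  exists c, cycle_in (S :\: L) c].

Section MaximalShell.

Variable L : {set T}.
Hypothesis shellL : shell L.
Hypothesis maxL : forall L', shell L' -> #|L'| <= #|L|.

Let J := S :\: L.

Lemma rest_neighbor v w : v \in J -> e v w -> w \in J :|: L.
Proof.
case: shellL => _ xL yL _ _; rewrite !inE => /andP[vL vS] vw.
have [//|wL] := boolP (w \in L); rewrite ?orbT //= orbF.
have [//|wS] := boolP (w \in S).
have: w \in boundary S by apply/boundaryP; split=> //; exists v.
by move/(subsetP boundaryS); rewrite !inE => /orP[]/eqP wE; rewrite wE ?xL ?yL in wL.
Qed.

Lemma rest_degree v : v \in J ->
  4 <= #|neighbors e v :&: J| + #|neighbors e v :&: L|.
Proof.
move=> vJ; have vS : v \in S by move: vJ; rewrite inE => /andP[].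
apply: leq_trans (degS vS) (card_neighbors_cover _).
by apply/subsetP => w; rewrite inE; apply: rest_neighbor.
Qed.

Lemma rest_boundary3 A : A != set0 -> A \subset J -> 3 <= #|boundary A|.
Proof.
case: shellL => _ _ _ /set0Pn[v]; rewrite inE => /andP[vL vS] _ A0 AJ.
apply: boundary3 => //; apply/properP; split.
  by apply: subset_trans AJ _; apply: subsetDl.
by exists v => //; apply: contraTN vL => /(subsetP AJ); rewrite inE => /andP[].
Qed.

(* Otherwise a path through [M] between the two attachments could be added to [L]. *)
Lemma attachment_unique c (M : {set T}) l1 l2 v1 v2 :
    cycle_in J c -> conn M -> M \subset J -> {in M, forall v, v \notin c} ->
    v1 \in M -> v2 \in M -> l1 \in L -> l2 \in L -> e v1 l1 -> e v2 l2 ->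
  l1 = l2.
Proof.
move=> [cc cJ] cM MJ Mc v1M v2M l1L l2L v1l1 v2l2; apply/eqP/contraT => l12.
have [s [ps us sM ls]] := connect_path v1M (cM _ _ v1M v2M).
have [bL xL yL LS _] := shellL.
have nL v : v \in v1 :: s -> v \notin L.
  by move/sM/(subsetP MJ); rewrite inE => /andP[].
suff /maxL : shell (L :|: [set w in v1 :: s]).
  rewrite leqNgt => /negP[]; apply: proper_card; apply/properP; split.
    exact: subsetUl.
  by exists v1; [rewrite !inE eqxx orbT | rewrite nL ?mem_head].
split; rewrite ?inE ?xL ?yL //.
- apply: (biconn_ear bL l1L l2L l12) => //.
  by rewrite rcons_path /= ls v2l2 ps e_sym v1l1.
- case/set0Pn: LS => v; rewrite inE => /andP[vL vS].
  by apply/set0Pn; exists v; rewrite !inE vL vS.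
exists c; split=> // v vc; have := cJ v vc; rewrite 3!inE in_set => /andP[vL ->].
rewrite (negPf vL) andbT /=; apply: contraTN vc => /sM; exact: Mc.
Qed.

Lemma attachment_card c (M : {set T}) : cycle_in J c -> conn M -> M \subset J ->
  {in M, forall v, v \notin c} -> #|boundary M :&: L| <= 1.
Proof.
move=> cc cM MJ Mc; apply/card_le1_eqP => l1 l2.
move=> /setIP[/boundaryP[_ [v1 v1M v1l1]] l1L] /setIP[/boundaryP[_ [v2 v2M v2l2]] l2L].
exact: (attachment_unique cc cM MJ Mc v2M v1M).
Qed.

Lemma conn1 v : conn [set v].
Proof. by move=> a b; rewrite !inE => /eqP-> /eqP->. Qed.

Lemma neighbors_card c v : cycle_in J c -> v \in J -> v \notin c ->
  #|neighbors e v :&: L| <= 1.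
Proof.
move=> cc vJ vc; apply/card_le1_eqP => l1 l2.
rewrite !inE => /andP[vl1 l1L] /andP[vl2 l2L].
apply: (@attachment_unique c [set v] l2 l1 v v) => //; rewrite ?inE //.
- exact: conn1.
- by rewrite sub1set.
- by move=> w; rewrite inE => /eqP->.
Qed.

(** * The case where every cycle of the rest is spanning *)

Section SpanningCycles.

Hypothesis spanning : forall c, cycle_in J c -> {subset J <= c}.

Lemma spanning_degree c v : cycle_in J c -> v \in J -> #|neighbors e v :&: J| <= 2.
Proof.
move=> cc vJ; have [[/andP[ec uc] sc] cJ] := cc; have vc := spanning cc vJ.
have [i s rs] := rot_to vc.
have cs w : (w \in c) = (w \in v :: s) by rewrite -rs mem_rot.
have us : uniq (v :: s) by rewrite -rs rot_uniq.
have es : cycle e (v :: s) by rewrite -rs rot_cycle.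
apply: (@leq_trans #|[set head v s; last v s]|); last by rewrite cards2; case: eqP.
apply: subset_leq_card; apply/subsetP => w; rewrite 2!inE => /andP[vw wJ].
have wv : w != v by apply: contraTneq vw => ->; rewrite e_irr.
have ws : w \in s by move: (spanning cc wJ); rewrite cs inE (negPf wv).
case/splitPr: ws => s1 s2 in rs cs us es *.
case: s1 => [|a s1] in rs cs us es *; first by rewrite !inE eqxx.
case: s2 => [|b s2] in rs cs us es *; first by rewrite last_cat !inE /= eqxx orbT.
(* A chord from [v] to [w] closes the arc of [c] up to [w]; this cycle leaves out the vertex [b]
   after [w], so it is not spanning. *)
pose c' := v :: rcons (a :: s1) w.
have c's z : z \in c' -> z \in c.
  by rewrite cs -cat_rcons -cat_cons mem_cat => ->.
have cc' : cycle_in J c'.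
  split; last by move=> z /c's/cJ.
  split; last by rewrite /= size_rcons.
  have pv : path e v (rcons (a :: s1) w).
    by move: es; rewrite -cat_rcons /cycle rcons_cat cat_path => /andP[].
  have uv : uniq c' by move: us; rewrite -cat_rcons -cat_cons cat_uniq => /andP[].
  by apply/andP; split; rewrite // /c' /cycle rcons_path pv last_rcons e_sym vw.
have bc : b \in c by rewrite cs !inE mem_cat !inE eqxx !orbT.
have := spanning cc' (cJ _ bc).
move: us; rewrite -cat_rcons -cat_cons cat_uniq.
by rewrite /= => /and3P[_ /norP[/negP nb _] _] /nb.
Qed.

Lemma spanning_wheel : False.
Proof.
have [bL xL yL LS [c cc]] := shellL; have [[/andP[ec uc] sc] cJ] := cc.
(* Of at least four neighbours, at most two are in [J]. *)
have degL v : v \in J -> 2 <= #|neighbors e v :&: L|.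
  move=> vJ; rewrite -(leq_add2l 2); apply: leq_trans (rest_degree vJ) _.
  by rewrite leq_add2r (spanning_degree cc).
case: c ec uc sc cJ {cc} => // d [|a [|b s]] // ec uc _ cJ.
have [dJ aJ zJ] : [/\ d \in J, a \in J & last b s \in J].
  by split; apply: cJ; rewrite ?inE ?eqxx ?orbT // -in_cons mem_last !orbT.
have /card_gt0P[u] : 0 < #|neighbors e d :&: L| by apply: leq_trans (degL d dJ).
have /card_gt1P[q1 [q2 [q1N q2N q12]]] := degL a aJ.
have /card_gt0P[p pN] : 0 < #|neighbors e (last b s) :&: L| by apply: leq_trans (degL _ zJ).
(* Two candidates for [q] ensure [p != q], as [biconn_through] requires. *)
have [q qN pq] : exists2 q, q \in neighbors e a :&: L & p != q.
  by have [pq|pq] := eqVneq p q1; [exists q2; rewrite // pq | exists q1].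
move: pN qN; rewrite !inE => /andP[zp pL] /andP[aq qL] /andP[du uL].
have [l [el ul lL ull [hl ll]]] := biconn_through bL pL qL uL pq.
move: ec; rewrite [cycle _ _]rcons_path /= => /andP[/and3P[da ab pbs] zd].
have disj w : w \in l -> w \notin d :: a :: b :: s.
  by move/lL => wL; apply/negP => /cJ; rewrite inE wL.
move: (uc); rewrite cons_uniq => /andP[ds us].
(* The rim is [c] without [d], closed up by the path [l] of [L]; the hub [d] sees [a], [last b s]
   and [u]. *)
apply: (@wheel_free_spokes ((a :: b :: s) ++ l) d a (last b s) u).
- apply/andP; split.
    case: (l) el ull hl ll => // p' l' el ull hl ll; rewrite /= in hl ll.
    rewrite (cycle_cat a (b :: s) p' l') /= ab pbs ll hl zp [e q a]e_sym aq andbT /=.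
    by rewrite -hl andbT.
  rewrite cat_uniq us ul andbT; apply/hasPn => w /disj.
  by rewrite inE negb_or => /andP[].
- rewrite mem_cat (negPf ds) /=; apply: contraTN isT => /lL dL.
  by move: dJ; rewrite inE dL.
- rewrite /= !inE !negb_or andbT; have ud := disj u ull.
  move: us; rewrite cons_uniq => /andP[abs _]; apply/andP; split.
    apply/andP; split; first by apply: contraNneq abs => ->; apply: mem_last.
    by apply: contraNneq ud => <-; rewrite !inE eqxx orbT.
  by apply: contraNneq ud => <-; rewrite !inE -in_cons mem_last !orbT.
- by rewrite mem_head.
- by rewrite mem_cat in_cons mem_last orbT.
- by rewrite mem_cat ull orbT.
- by [].
- by rewrite e_sym.
- by [].
Qed.

End SpanningCycles.

(** * A cycle with a largest connected set off it *)

Definition bridge c (M : {set T}) := [/\ cycle_in J c, M \subset J, conn M, M != set0 &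
  {in M, forall v, v \notin c}].

Section MaximalBridge.

Variables (c : seq T) (M : {set T}).
Hypothesis bridgeM : bridge c M.
(** Maximality ranges over the cycle as well, so rerouting [c] to let a vertex join [M] is a
    contradiction. *)
Hypothesis maxM : forall c' M', bridge c' M' -> #|M'| <= #|M|.

Definition attached v := [exists w in M, e v w].

Lemma bridge_closed v w : w \in M -> e w v -> v \in J -> v \notin c -> v \in M.
Proof.
have [cc MJ cM M0 Mc] := bridgeM => wM wv vJ vc; apply: contraT => vM.
have := @maxM c (v |: M); rewrite cardsU1 vM ltnn => -> //; split=> //.
- by rewrite subUset sub1set vJ.
- exact: conn_setU1 cM wM wv.
- by apply/set0Pn; exists v; rewrite setU11.
by move=> z /setU1P[->|/Mc].
Qed.

(* Otherwise the ear replaces the arc [q], and [w] joins the component [M]. *)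
Lemma ear_unattached a p b q s w :
    ucycle e (a :: p ++ b :: q) -> a :: p ++ b :: q =i c ->
    path e a (rcons s b) -> uniq s ->
    {in s, forall z, [/\ z \in J, z \notin c & z \notin M]} ->
    0 < size p + size s -> w \in q -> ~~ attached w.
Proof.
move=> /andP[ec' uc'] c'c ps us sout szps wq.
have [[cc cJ] MJ cM M0 Mc] := bridgeM.
have wc : w \in c by rewrite -c'c inE mem_cat inE wq !orbT.
have wM : w \notin M by apply: contraL wc => /Mc.
apply/exists_inP => -[z zM wz].
pose c2 := a :: p ++ b :: rev s.
have c2P v : v \in c2 -> v \in s \/ v \in c /\ v \notin q.
  rewrite /c2 -cat_cons -cat_rcons mem_cat mem_rev => /orP[vabp|]; [right|by left].
  move: uc'; rewrite -c'c -cat_cons -cat_rcons mem_cat vabp cat_uniq.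
  by case/and3P=> _ /hasPn abpq _; split=> //; apply: contraTN vabp => /abpq.
have := @maxM c2 (w |: M); rewrite cardsU1 wM ltnn => /(_ _)/notF; case; split.
- split; last by move=> v /c2P[/sout[]|[/cJ]].
  split.
    apply/andP; split.
      move: ec' ps; rewrite path_rev_ear !cycle_cat rcons_path.
      by case/and4P=> -> -> _ _ /andP[-> ->].
    move: uc'; rewrite /c2 -!cat_cons -!cat_rcons !cat_uniq => /and3P[-> _ _].
    rewrite rev_uniq us andbT /=; apply/hasPn => v; rewrite mem_rev => /sout[_ vc _].
    by apply: contra vc; rewrite -c'c -cat_cons -cat_rcons mem_cat => ->.
  rewrite /= size_cat /= size_rev addnS ltnS.
  by rewrite -addnS addnS ltnS.
- by rewrite subUset sub1set cJ.
- by apply: conn_setU1 cM zM _; rewrite e_sym.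
- by apply/set0Pn; exists w; rewrite setU11.
move=> v /setU1P[->|vM]; apply/negP => /c2P[vs|[vc]].
- by have [_ /negP] := sout _ vs.
- by rewrite wq.
- by have [_ _ /negP] := sout _ vs.
by move: vc; rewrite (negPf (Mc _ vM)).
Qed.

(** [ear_unattached] applies to both arcs, after rotating the cycle and reversing the ear. The two
    size conditions keep each rerouted cycle at length at least 3. *)
Lemma ear_attached a p b q s w :
    ucycle e (a :: p ++ b :: q) -> a :: p ++ b :: q =i c ->
    path e a (rcons s b) -> uniq s ->
    {in s, forall z, [/\ z \in J, z \notin c & z \notin M]} ->
    0 < size p + size s -> 0 < size q + size s ->
  w \in c -> attached w -> w \in [:: a; b].
Proof.
move=> uc' c'c ps us sout szp szq wc aw; rewrite -c'c inE mem_cat inE in wc.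
case/or4P: wc => [/eqP->|wp|/eqP->|wq]; rewrite ?inE ?eqxx ?orbT //; last first.
  by move: aw; rewrite (negPf (ear_unattached uc' c'c ps us sout szp wq)).
apply: contraLR aw => _; apply: (@ear_unattached b q a p (rev s)) => //;
  rewrite ?rev_uniq ?size_rev //.
- by rewrite -(rot_ucycle (size (b :: q))) rot_size_cat.
- by move=> z; rewrite -c'c -[a :: p ++ _]cat_cons -[b :: q ++ _]cat_cons !mem_cat orbC.
- by rewrite -path_rev_ear.
- by move=> z; rewrite mem_rev => /sout.
Qed.

Lemma cycle_rot2 a b : a \in c -> b \in c -> a != b ->
  exists p q, ucycle e (a :: p ++ b :: q) /\ a :: p ++ b :: q =i c.
Proof.
have [[[uc _] _] _ _ _ _] := bridgeM => ac bc ab.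
have [i s rs] := rot_to ac.
have bs : b \in s by move: bc; rewrite -(mem_rot i) rs inE eq_sym (negPf ab).
case/splitPr: bs => p q in rs *; exists p, q.
by split; [rewrite -rs rot_ucycle | move=> z; rewrite -rs mem_rot].
Qed.

(** Of at least three boundary vertices, at most one is in [L]; the others are in [J], hence on [c],
    because [C] is closed within [J] off [c]. *)
Lemma boundary_bridge (C : {set T}) : C != set0 -> C \subset J -> conn C ->
    {in C, forall v, v \notin c} ->
    (forall v w, w \in C -> e w v -> v \in J -> v \notin c -> v \in C) ->
  2 <= #|boundary C :&: [set z in c]|.
Proof.
have [cc _ _ _ _] := bridgeM => C0 CJ cC Cc closC.
have le3 := rest_boundary3 C0 CJ; have leL := attachment_card cc cC CJ Cc.
rewrite -ltnS -[X in _ <= X]addn1; apply: leq_trans le3 _.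
apply: (@leq_trans (#|boundary C :&: [set z in c]| + #|boundary C :&: L|)); last first.
  by rewrite leq_add2l.
rewrite -[X in X <= _](cardsID [set z in c] (boundary C)) leq_add2l.
apply: subset_leq_card; apply/subsetP => v /setDP[vb vc]; rewrite inE vb /=.
rewrite inE in vc.
case/boundaryP: vb => vC [w wC wv].
have := rest_neighbor (subsetP CJ _ wC) wv; rewrite inE => /orP[vJ|//].
by rewrite (closC v w) in vC.
Qed.

Lemma two_attached : exists a b,
  [/\ a \in c, b \in c, a != b, attached a & attached b].
Proof.
have [cc MJ cM M0 Mc] := bridgeM.
have /card_gt1P[a [b [+ + ab]]] := boundary_bridge M0 MJ cM Mc (fun v w => @bridge_closed v w).
move=> /setIP[/boundaryP[_ [v vM va]] ac] /setIP[/boundaryP[_ [w wM wb]] bc].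
rewrite !in_set in ac bc; exists a, b; split=> //; apply/exists_inP.
  by exists v; rewrite // e_sym.
by exists w; rewrite // e_sym.
Qed.

(** [C] is the component of [z] in [J] off [c], disjoint from [M]. A path through it between two of
    its attachments is an ear of [c], to which [ear_attached] applies. *)
Lemma other_component z : z \in J -> z \notin c -> z \notin M ->
  exists C : {set T}, [/\ z \in C, {in C, forall v, v \notin c},
    2 <= #|boundary C :&: [set v in c]| &
    forall a b w, a \in boundary C -> a \in c -> b \in boundary C -> b \in c ->
      a != b -> w \in c -> attached w -> w \in [:: a; b]].
Proof.
have [[cc cJ] MJ cM M0 Mc] := bridgeM => zJ zc zM.
pose A := J :\: [set v in c].
have AP v : (v \in A) = (v \in J) && (v \notin c) by rewrite 2!inE in_set andbC.
have zA : z \in A by rewrite AP zJ.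
pose C := [set v | connect (induced_rel A) z v].
have CA v : v \in C -> v \in A by rewrite inE; apply: connect_induced_mem.
have CM v : v \in C -> v \notin M.
  rewrite inE; apply: (connect_closed (P := fun v => v \notin M)) => // a b aM.
  case/and3P => + bA ab; rewrite AP => /andP[aJ ac]; apply: contra aM => bM.
  by apply: bridge_closed bM _ aJ ac; rewrite e_sym.
have clos v w : w \in C -> e w v -> v \in J -> v \notin c -> v \in C.
  move=> wC wv vJ vc; have wA := CA _ wC; rewrite !in_set in wC *.
  apply: connect_trans wC (connect_edge wA _ wv); by rewrite AP vJ.
have connC : conn C.
  apply: (@conn_hub _ z) => v; rewrite in_set => /(connect_path zA)[s [ps _ sA <-]].
  apply: (path_connect ps); last exact: mem_last.
  by move=> w ws; rewrite in_set; apply: path_connect ps sA w ws.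
have zC : z \in C by rewrite in_set connect0.
exists C; split=> //; first by move=> v /CA; rewrite AP => /andP[].
  apply: boundary_bridge => //.
  - by apply/set0Pn; exists z.
  - by apply/subsetP => v /CA; rewrite AP => /andP[].
  - by move=> v /CA; rewrite AP => /andP[].
move=> a b w /boundaryP[_ [a' a'C a'a]] ac /boundaryP[_ [b' b'C b'b]] bc ab wc aw.
have [p [q [uc' c'c]]] := cycle_rot2 ac bc ab.
have [s [ps us sC ls]] := connect_path a'C (connC _ _ a'C b'C).
apply: (ear_attached (s := a' :: s) uc' c'c) => //.
- by rewrite /= rcons_path ps ls b'b e_sym a'a.
- by move=> v vs; have vC := sC v vs; move: (CA v vC) (CM v vC); rewrite AP => /andP[].
- by rewrite addnS.
- by rewrite addnS.
Qed.

(** If [d] is on [c], the arc of [c] between [a] and [b] that avoids [d] is closed by a path through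
    [M]. *)
Lemma cycle_avoiding a b d :
    a \in c -> b \in c -> a != b -> attached a -> attached b ->
    d != a -> d != b ->
  exists2 c', cycle_in J c' & d \notin c'.
Proof.
have [[[/andP[ec uc] sc] cJ] MJ cM M0 Mc] := bridgeM.
move=> ac bc ab aa bb da db; have [dc|dc] := boolP (d \in c); last first.
  by exists c => //; do 2!split=> //; apply/andP.
have [p [q [uc' c'c]]] := cycle_rot2 ac bc ab.
wlog dp : a b p q ac bc ab aa bb da db uc' c'c / d \notin p.
  move=> IH; have [dp|] := boolP (d \in p); last exact: (IH a b p q).
  apply: (IH b a q p) => //; rewrite 1?eq_sym //.
  - by rewrite -(rot_ucycle (size (b :: q))) rot_size_cat.
  - by move=> z; rewrite -c'c -[a :: p ++ _]cat_cons -[b :: q ++ _]cat_cons !mem_cat orbC.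
  move: uc' => /andP[_]; rewrite cons_uniq cat_uniq => /and4P[_ _ /hasPn pbq _].
  by apply/negP => dq; move: (pbq d); rewrite inE dq orbT /= dp => /(_ isT).
have [[a' a'M aa'] [b' b'M bb']] := (exists_inP aa, exists_inP bb).
have [s [ps us sM ls]] := connect_path b'M (cM _ _ b'M a'M).
move: uc' => /andP[ec' uc'].
have rP v : v \in rcons (a :: p) b -> v \in c.
  by rewrite -c'c -cat_cons -cat_rcons mem_cat => ->.
exists (rcons (a :: p) b ++ b' :: s).
  split; last first.
    by move=> v; rewrite mem_cat => /orP[/rP/cJ|/sM/(subsetP MJ)].
  split; last by rewrite size_cat size_rcons /= addnS addSn.
  apply/andP; split.
    move: ec'; rewrite (cycle_cat a p b q) => /and4P[pa pab _ _].
    by rewrite rcons_cons cycle_cat rcons_path pa pab last_rcons bb' ps ls e_sym.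
  rewrite cat_uniq us andbT; apply/andP; split.
    by move: uc'; rewrite -cat_cons -cat_rcons cat_uniq => /andP[].
  by apply/hasPn => v /sM/Mc; apply: contra => /rP.
rewrite mem_cat mem_rcons !inE !negb_or db da dp -negb_or -in_cons.
by apply: contraL dc => /sM/Mc.
Qed.

(** An unattached [d] is missed by some cycle, so it has at most one neighbour in [L] and at least
    three in [J]. One of these, [z], is not next to [d] on [c]. The chord to [z], or a path through
    the component of [z], is an ear at [d] whose two ends include all attached vertices; as [d] is
    not attached, this contradicts [two_attached]. *)
Lemma all_attached d : d \in c -> attached d.
Proof.
have [[[uc sc] cJ] MJ cM M0 Mc] := bridgeM => dc; apply/contraT => dM.
have [a [b [ac bc ab aa bb]]] := two_attached.
have da : d != a by apply: contraNneq dM => ->.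
have db : d != b by apply: contraNneq dM => ->.
have [c' cc' dc'] := cycle_avoiding ac bc ab aa bb da db.
have only_d z : a \in [:: d; z] -> b \in [:: d; z] -> False.
  rewrite !inE eq_sym (negPf da) [b == d]eq_sym (negPf db) /= => /eqP az /eqP bz.
  by move: ab; rewrite az bz eqxx.
have [i s rs] := rot_to dc.
have [z zN zO] : exists2 z, z \in neighbors e d :&: J & z \notin [set head d s; last d s].
  apply/subsetPn; apply/negP => /subset_leq_card; apply/negP; rewrite -ltnNge.
  apply: (@leq_ltn_trans 2); first by rewrite cards2; case: eqP.
  rewrite -(leq_add2r 1); apply: leq_trans (rest_degree (cJ _ dc)) _.
  by rewrite leq_add2l (neighbors_card cc' (cJ _ dc) dc').
move: zN zO => /setIP[+ zJ]; rewrite !inE negb_or => dz /andP[zh zl].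
have zM : z \notin M by apply: contra dM => zM; apply/exists_inP; exists z.
have zd : z != d by apply: contraTneq dz => ->; rewrite e_irr.
have [zc|zc] := boolP (z \in c).
  have zs : z \in s by move: zc; rewrite -(mem_rot i) rs inE (negPf zd).
  case/splitPr: zs => p q in rs zh zl *.
  have p0 : 0 < size p by move: zh; case: (p) => //=; rewrite eqxx.
  have q0 : 0 < size q by move: zl; case: (q) => //=; rewrite last_cat /= eqxx.
  have uc' : ucycle e (d :: p ++ z :: q) by rewrite -rs rot_ucycle.
  have c'c : d :: p ++ z :: q =i c by move=> v; rewrite -rs mem_rot.
  have att := @ear_attached d p z q [::] _ uc' c'c.
  by exfalso; apply: (only_d z); apply: att; rewrite //= ?dz ?addn0.
have [C [zC Cc C2 att]] := other_component zJ zc zM.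
have dC : d \in boundary C.
  apply/boundaryP; split; last by exists z; rewrite // e_sym.
  by apply: contraTN dc => /Cc.
have [z' z'C z'd] : exists2 z', z' \in boundary C :&: [set v in c] & z' != d.
  have /card_gt1P[z1 [z2 [z1C z2C z12]]] := C2.
  by have [z1d|z1d] := eqVneq z1 d; [exists z2; rewrite // -z1d eq_sym|exists z1].
move: z'C; rewrite inE in_set => /andP[z'C z'c].
by exfalso; apply: (only_d z'); apply: att; rewrite // eq_sym.
Qed.

(** A further component would leave at most two attached vertices, but [c] has at least three and
    all are attached. *)
Lemma bridge_cover v : v \in J -> (v \in c) || (v \in M).
Proof.
have [[[/andP[_ uc] sc] _] _ _ _ _] := bridgeM => vJ; apply/contraT.
rewrite negb_or => /andP[vc vM].
have [C [_ _ C2 att]] := other_component vJ vc vM.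
have /card_gt1P[a [b [/setIP[aC ac] /setIP[bC bc] ab]]] := C2.
rewrite !in_set in ac bc; move: sc; rewrite leqNgt => /negP[].
apply: (uniq_leq_size uc (s2 := [:: a; b])) => w wc.
by apply: att; rewrite // all_attached.
Qed.

(** [J] has at least three boundary vertices, all in [L], and [M] accounts for at most one of them;
    since [c] and [M] cover [J], two others come from [c]. *)
Lemma cycle_attachments : exists d d' l l',
  [/\ d \in c, d' \in c & [/\ l \in L, l' \in L, l != l', e d l & e d' l']].
Proof.
have [[[uc sc] cJ] MJ cM M0 Mc] := bridgeM.
have cMJ : M :|: [set v in c] = J.
  apply/setP => v; rewrite inE in_set; apply/idP/idP; last by rewrite orbC; apply: bridge_cover.
  by case/orP => [/(subsetP MJ)|/cJ].
have J0 : J != set0.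
  by apply: contraNneq M0 => J0; rewrite -subset0 -J0.
have le3 := rest_boundary3 J0 (subxx J).
have le1 := attachment_card (conj (conj uc sc) cJ) cM MJ Mc.
have bL v : v \in boundary J -> v \in L.
  case/boundaryP => vJ [w wJ wv]; have := rest_neighbor wJ wv.
  by rewrite inE (negPf vJ).
have : 2 <= #|boundary J :\: boundary M|.
  have := cardsID (boundary M) (boundary J) => cardJ.
  have : #|boundary J :&: boundary M| <= 1.
    apply: leq_trans le1; apply: subset_leq_card; apply/subsetP => v.
    by rewrite in_setI => /andP[/bL vL vM]; rewrite in_setI vM.
  rewrite -(leq_add2r #|boundary J :\: boundary M|) cardJ => le.
  by have := leq_trans le3 le; rewrite add1n ltnS.
case/card_gt1P => l [l' [lN l'N ll']].
have from_c v : v \in boundary J :\: boundary M -> v \in L /\ exists2 d, d \in c & e d v.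
  case/setDP => vJ vM; split; first exact: bL.
  case/boundaryP: vJ => vJ [w wJ wv]; exists w => //.
  have := bridge_cover wJ; case/orP => // wM; case/negP: vM.
  by apply/boundaryP; split; [apply: contra vJ => /(subsetP MJ) | exists w].
have [[lL [d dc dl]] [l'L [d' d'c d'l']]] := (from_c _ lN, from_c _ l'N).
by exists d, d', l, l'.
Qed.

(** Given a cycle inside [M], the roles swap: the vertices of [c] form a connected subset of [J]
    avoiding it, so they would share a single neighbour in [L], contrary to [cycle_attachments]. *)
Lemma bridge_acyclic : ~ exists c', cycle_in M c'.
Proof.
have [[[uc sc] cJ] MJ cM M0 Mc] := bridgeM => -[c' [gc' c'M]].
have [d [d' [l [l' [dc d'c [lL l'L ll' dl d'l']]]]]] := cycle_attachments.
case/negP: ll'; apply/eqP.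
apply: (@attachment_unique c' [set v in c] l l' d d'); rewrite ?in_set //.
- by split=> // v /c'M/(subsetP MJ).
- by have [] := biconn_cycle (conj uc sc).
- by apply/subsetP => v; rewrite in_set => /cJ.
by move=> v; rewrite in_set; apply: contraL => /c'M/Mc.
Qed.

(** The rim follows [c] from [d] to [z], passes [m2], [l1] and a path of [L] to [l2], and returns to
    [d]. The hub [m1] sees [l1] and two vertices of the arc from [d] to [z]. *)
Lemma farthest_wheel d s s1 z s2 m1 m2 l1 l2 :
    ucycle e (d :: s) -> d :: s =i c -> s = s1 ++ z :: s2 ->
    m1 \in M -> m2 \in M -> m1 != m2 -> e m2 z ->
    {in c, forall w, e m1 w -> w \in d :: rcons s1 z} ->
    2 <= #|neighbors e m1 :&: [set w in c]| ->
    l1 \in L -> l2 \in L -> e m1 l1 -> e m2 l1 -> e d l2 -> False.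
Proof.
have [_ MJ cM M0 Mc] := bridgeM.
have [[cL _] _ _ _ _] := shellL.
move=> /andP[es us] sc def_s m1M m2M m12 m2z m1c two1 l1L l2L m1l1 m2l1 dl2.
have [t [pt ut tL lt]] := connect_path l1L (cL _ _ l1L l2L).
have ML v : v \in M -> v \notin L.
  by move/(subsetP MJ); rewrite inE => /andP[].
have rc v : v \in d :: rcons s1 z -> v \in c.
  by rewrite -sc def_s -cat_rcons -cat_cons mem_cat => ->.
have cL' v : v \in c -> v \notin L.
  by have [[_ cJ] _ _ _ _] := bridgeM => /cJ; rewrite inE => /andP[].
have /card_gt1P[a [b [/setIP[+ ac] /setIP[+ bc] ab]]] := two1.
rewrite !in_set in ac bc *; move=> m1a m1b.
have ar := m1c a ac m1a; have br := m1c b bc m1b.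
apply: (@wheel_free_spokes ((d :: rcons s1 z) ++ m2 :: l1 :: t) m1 a b l1) => //.
- apply/andP; split.
    have ps : path e d (rcons s1 z).
      by move: es; rewrite def_s -cat_rcons /cycle rcons_cat cat_path => /andP[].
    by rewrite (cycle_cat d (rcons s1 z) m2 (l1 :: t)) ps last_rcons [e z _]e_sym m2z /= m2l1 pt lt e_sym.
  rewrite cat_uniq [uniq (m2 :: _)]cons_uniq ut andbT; apply/and3P; split.
  - by move: us; rewrite def_s -cat_rcons -cat_cons cat_uniq => /andP[].
  - apply/hasPn => v; rewrite inE => /predU1P[->|vt].
      by apply: contra (Mc _ m2M) => /rc.
    by apply: contraL (tL v vt) => /rc/cL'.
  by apply: contra (ML _ m2M) => /tL.
- rewrite mem_cat; apply/norP; split.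
    by apply: contra (Mc _ m1M) => /rc.
  by rewrite inE (negPf m12); apply: contra (ML _ m1M) => /tL.
- rewrite /= !inE negb_or ab andbT /=; apply/andP; split; [move: ac | move: bc];
    by apply: contraTneq => ->; apply: contraL l1L => /cL'.
- by rewrite mem_cat ar.
- by rewrite mem_cat br.
by rewrite mem_cat !inE eqxx !orbT.
Qed.

Lemma last_occurrence (a : pred T) s : has a s ->
  exists s1 z s2, [/\ s = s1 ++ z :: s2, a z & ~~ has a s2].
Proof.
elim: s => //= u s IHs; have [/IHs [s1 [z [s2 [-> az ns2]]]] _|ns] := boolP (has a s).
  by exists (u :: s1), z, s2.
by rewrite orbF => au; exists [::], u, s.
Qed.

Lemma bridge_wheel : False.
Proof.
have [[[uc sc] cJ] MJ cM M0 Mc] := bridgeM.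
have cc : cycle_in J c := conj (conj uc sc) cJ.
have degM m : m \in M -> [/\ #|neighbors e m :&: L| <= 1,
    #|neighbors e m :&: [set w in c]| <= 2 &
    4 <= #|neighbors e m :&: M| + #|neighbors e m :&: [set w in c]|
         + #|neighbors e m :&: L|].
  move=> mM; have mJ := subsetP MJ _ mM; split.
  - exact: neighbors_card cc mJ (Mc _ mM).
  - exact: wheel_free_le2 (conj uc sc) (Mc _ mM).
  apply: leq_trans (rest_degree mJ) _; rewrite leq_add2r.
  apply: (@leq_trans #|(neighbors e m :&: M) :|: (neighbors e m :&: [set w in c])|).
    apply: subset_leq_card; apply/subsetP => w; rewrite -setIUr !in_setI => /andP[-> /bridge_cover].
    by rewrite in_setU in_set orbC.
  by rewrite cardsU leq_subr.
have [m1 [m2 [m1M m2M m1end m2end m12]]] := acyclic_ends M0 bridge_acyclic.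
(* Without a neighbour in [M], the vertex [m1] would have at most 2 + 1 neighbours. *)
have {}m12 : m1 != m2.
  apply: m12; rewrite -card_gt0; have [leL lec] := degM _ m1M.
  by case: #|_ :&: M| => // /leq_trans/(_ (leq_add lec leL)).
(* The bounds 1, 2 and 1 in [M], on [c] and in [L] add up to exactly 4, so each is attained. *)
have leaf m : m \in M -> #|neighbors e m :&: M| <= 1 ->
    2 <= #|neighbors e m :&: [set w in c]| /\ exists2 l, l \in L & e m l.
  move=> mM endm; have [leL lec ge4] := degM _ mM; split.
    rewrite leqNgt; apply/negP; rewrite ltnS => lec1.
    by have := leq_trans ge4 (leq_add (leq_add endm lec1) leL).
  have /card_gt0P[l] : 0 < #|neighbors e m :&: L|.
    rewrite lt0n; apply/eqP => L0; move: ge4; rewrite L0 addn0 => ge4.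
    by have := leq_trans ge4 (leq_add endm lec).
  by rewrite !inE => /andP[ml lL]; exists l.
have [two1 [l1 l1L m1l1]] := leaf _ m1M m1end.
have [two2 [l2 l2L m2l2]] := leaf _ m2M m2end.
have l12 := attachment_unique cc cM MJ Mc m1M m2M l1L l2L m1l1 m2l2.
rewrite -{}l12 {l2L} in m2l2.
have [d [_ [l [_ [dc _ [lL _ _ dl _]]]]]] := cycle_attachments.
have [i s rs] := rot_to dc.
have uds : ucycle e (d :: s) by rewrite -rs rot_ucycle.
have dsc : d :: s =i c by move=> v; rewrite -rs mem_rot.
(* Such a [z] exists because one of the two neighbours of [m1] on [c] differs from [d]. *)
have [|s1 [z [s2 [def_s mz far]]]] := @last_occurrence (fun w => e m1 w || e m2 w) s.
  have /card_gt1P[a [b [/setIP[+ ac] /setIP[+ bc] ab]]] := two1.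
  rewrite !in_set in ac bc *; move=> m1a m1b; apply/hasP.
  move: ac bc; rewrite -!dsc !inE; have [ad _|ad /= sa _] := eqVneq a d.
    rewrite -ad eq_sym (negPf ab) /= => sb; exists b => //; by rewrite m1b.
  by exists a; rewrite // m1a.
have near m : m \in [:: m1; m2] -> {in c, forall w, e m w -> w \in d :: rcons s1 z}.
  move=> mm w; rewrite -dsc def_s -cat_rcons -cat_cons mem_cat => /orP[//|ws2 mw].
  case/hasP: far; exists w => //; move: mm mw; rewrite !inE => /orP[]/eqP-> ->//.
  by rewrite orbT.
(* One of [m1], [m2] that sees [z] goes on the rim, and the other becomes the hub. *)
case/orP: mz => mz.
  apply: (farthest_wheel uds dsc def_s m2M m1M _ mz (near m2 _) two2 l1L lL m2l2 m1l1 dl).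
    by rewrite eq_sym.
  by rewrite !inE eqxx orbT.
apply: (farthest_wheel uds dsc def_s m1M m2M m12 mz (near m1 _) two1 l1L lL m1l1 m2l2 dl).
by rewrite !inE eqxx.
Qed.

End MaximalBridge.

Lemma maximal_shell_wheel : False.
Proof.
have [span|nospan] := classic (forall c, cycle_in J c -> {subset J <= c}).
  exact: spanning_wheel span.
have [c [v [cc vJ vc]]] : exists c v, [/\ cycle_in J c, v \in J & v \notin c].
  apply: NNPP => nov; apply: nospan => c cc v vJ; apply/contraT => vc.
  by case: nov; exists c, v.
pose P cM := bridge cM.1 cM.2.
have [||[c' M] bM maxM] := @ex_maximal _ P (fun cM => #|cM.2|) #|T|.
- by move=> cM _; apply: max_card.
- exists (c, [set v]); split=> //=.
  + by rewrite sub1set.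
  + exact: conn1.
  + by apply/set0Pn; exists v; rewrite inE.
  by move=> w; rewrite inE => /eqP->.
by apply: bridge_wheel bM _ => c2 M2; apply: (maxM (c2, M2)).
Qed.

End MaximalShell.

Lemma no_shell L : ~ shell L.
Proof.
move=> shL; have [||L' shL' maxL] := @ex_maximal _ shell (fun L => #|L|) #|T|.
- by move=> L' _; apply: max_card.
- by exists L.
exact: maximal_shell_wheel shL' maxL.
Qed.

(** * A shell in a minimal fragment *)

Hypotheses (S0 : S != set0) (xy : x != y) (xS : x \notin S).
Hypothesis connxy : connect (induced_rel (~: S)) x y.

(** A component of [S] has its boundary inside [boundary S], hence at most two boundary vertices, so
    it cannot be proper. *)
Lemma fragment_conn : conn S.
Proof.
have W u : u \in S -> [set w | connect (induced_rel S) u w] = S.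
  move=> uS; pose W := [set w | connect (induced_rel S) u w]; rewrite -/W.
  have WS : W \subset S.
    by apply/subsetP => w; rewrite inE; apply: connect_induced_mem.
  apply/eqP/contraT => neW; have /boundary3 : W \proper S by rewrite properEneq neW.
  have /[swap]/[apply] : W != set0 by apply/set0Pn; exists u; rewrite inE connect0.
  rewrite leqNgt => /negP[]; apply: (@leq_ltn_trans #|[set x; y]|); last first.
    by rewrite cards2; case: eqP.
  apply: subset_leq_card; apply/subsetP => v /boundaryP[vW [w wW wv]].
  have wS := subsetP WS w wW.
  apply: (subsetP boundaryS); apply/boundaryP; split; last by exists w.
  apply: contra vW => vS; rewrite !inE in wW *.
  exact: connect_trans wW (connect_edge wS vS wv).
by move=> u v uS vS; move: (vS); rewrite -{1}(W u uS) inE.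
Qed.

(** Otherwise removing a vertex [c] from [S] leaves a nonempty proper subset with boundary inside
    [[set b; c]]. *)
Lemma fragment_boundary_card b : ~ boundary S \subset [set b].
Proof.
move=> bS; have [c cS] := set0Pn _ S0.
have SP w : w \in neighbors e c -> (w == b) || (w \in S :\ c).
  rewrite inE => cw; have wc : w != c by apply: contraTneq cw => ->; rewrite e_irr.
  rewrite in_setD1 wc; have [wS|wS] := boolP (w \in S); rewrite ?orbT // orbF.
  by rewrite -in_set1; apply: (subsetP bS); apply/boundaryP; split=> //; exists c.
have /card_gt1P[w1 [w2 [w1N w2N w12]]] : 2 <= #|neighbors e c|.
  by apply: leq_trans (degS cS).
have Sc0 : S :\ c != set0.
  apply/set0Pn; have /orP[/eqP w1b|] := SP _ w1N; last by exists w1.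
  have /orP[/eqP w2b|] := SP _ w2N; last by exists w2.
  by move: w12; rewrite w1b w2b eqxx.
have := boundary3 Sc0 (properD1 cS); rewrite leqNgt => /negP[].
apply: (@leq_ltn_trans #|[set b; c]|); last by rewrite cards2; case: eqP.
apply: subset_leq_card; apply/subsetP => v /boundaryP[vS [w /setD1P[_ wS] wv]].
have [->|vc] := eqVneq v c; first by rewrite !inE eqxx orbT.
rewrite !inE vc /= in vS; rewrite in_set2 -in_set1; apply/orP; left.
by apply: (subsetP bS); apply/boundaryP; split=> //; exists w.
Qed.

(** A path from [x] to [y] outside [S] and a shortest way back through [S] form a cycle whose vertex
    set is a shell: a vertex of [S] off the cycle has at most two of its four neighbours on it, and
    the others stay in [S]. *)
Lemma fragment_wheel : False.
Proof.
have xcS : x \in ~: S by rewrite inE.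
have yS : y \notin S by have := connect_induced_mem xcS connxy; rewrite inE.
have [xb yb] : x \in boundary S /\ y \in boundary S.
  have sub2 a b : boundary S \subset [set a; b] -> a \in boundary S.
    move=> ab; apply/contraT => aS; case: (@fragment_boundary_card b).
    apply/subsetP => v vS; have := subsetP ab v vS; rewrite !inE.
    by case: eqP => // va; rewrite -va vS in aS.
  by split; [apply: sub2 boundaryS | apply: (sub2 y x); rewrite setUC].
have [[_ [x' x'S x'x]] [_ [y' y'S y'y]]] := (boundaryP _ _ xb, boundaryP _ _ yb).
have [r [pr ur rS lr]] := connect_path xcS connxy.
pose P (p : T * seq T) := [/\ path e p.1 p.2, uniq (p.1 :: p.2),
  {subset p.1 :: p.2 <= S}, e y p.1 & e (last p.1 p.2) x].
have [[p0 p] [/= pp up pS yp0 px] minp] : exists2 p, P p &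
    forall q, P q -> size p.2 <= size q.2.
  apply: (@ex_minimal _ P (fun p => size p.2)).
  have [s [ps us sS ls]] := connect_path y'S (fragment_conn y'S x'S).
  by exists (y', s); split; rewrite //= ?ls // e_sym.
pose c := x :: r ++ p0 :: p.
have r0 : r != [::] by apply: contraNneq xy => r0; rewrite -lr r0.
have cc : graph_cycle e c.
  split; last by move: r0; rewrite /= size_cat /= addnS; case: (r).
  apply/andP; split; first by rewrite cycle_cat pr lr yp0 pp px.
  rewrite /c -cat_cons cat_uniq ur (up : uniq (p0 :: p)) andbT; apply/hasPn => v /pS vS.
  by apply/negP => /rS; rewrite inE vS.
have xc : x \in c by rewrite mem_head.
have yc : y \in c by rewrite /c -cat_cons mem_cat -lr mem_last.
have cS v : v \in S -> v \in c -> v \in p0 :: p.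
  by move=> vS; rewrite /c -cat_cons mem_cat => /orP[/rS|//]; rewrite inE vS.
have nS v w : v \in S -> e v w -> [|| w == x, w == y | w \in S].
  move=> vS vw; have [wS|wS] := boolP (w \in S); rewrite ?orbT // orbF -in_set2.
  by apply: (subsetP boundaryS); apply/boundaryP; split=> //; exists v.
apply: (@no_shell [set v in c]); split; rewrite ?in_set //.
- exact: biconn_cycle.
- apply/set0Pn; exists p0; rewrite in_setI in_set /c -cat_cons mem_cat mem_head orbT /=.
  exact/pS/mem_head.
apply: cycle_of_mindeg2.
  apply/set0Pn; apply: NNPP => noS.
  have p0S : p0 \in S by apply/pS/mem_head.
  (* Four neighbours leave one besides [x], [y] and the successor of [p0]; the default [p0] covers
     an empty [p]. *)
  have [w p0w] : exists2 w, w \in neighbors e p0 & w \notin [set x; y; head p0 p].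
    apply/subsetPn; apply/negP => /subset_leq_card; apply/negP; rewrite -ltnNge.
    apply: leq_trans (degS p0S); rewrite ltnS.
    rewrite cardsU cards2 cards1; apply: leq_trans (leq_subr _ _) _.
    by rewrite addn1; case: eqP.
  rewrite !inE !negb_or in p0w *; case/andP=> /andP[wx wy] wh.
  have wS : w \in S by have := nS _ _ p0S p0w; rewrite (negPf wx) (negPf wy).
  have wp0 : w != p0 by apply: contraTneq p0w => ->; rewrite e_irr.
  have wp : w \in p.
    have : w \in p0 :: p.
      apply: cS => //; apply/contraT => wc; case: noS; exists w.
      by rewrite in_setD in_set wc.
    by rewrite inE (negPf wp0).
  case/splitPr: wp => s1 s2 in pp up pS px minp wh *.
  (* The edge from [p0] to [w] would shorten the path. *)
  have := minp (p0, w :: s2); rewrite /= size_cat leqNgt.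
  case: s1 => [|a s1] in pp up pS px minp wh *; first by move: wh; rewrite eqxx.
  rewrite /= addSn ltnS leq_addl => /(_ _)/notF; case; split=> /=.
  - by rewrite p0w; move: pp; rewrite cat_path /= => /and3P[].
  - have := cat_subseq (subseq_refl [:: p0]) (suffix_subseq (a :: s1) (w :: s2)).
    by move/subseq_uniq; apply.
  - move=> v vs; apply: pS; move: vs; rewrite !inE mem_cat inE => /or3P[]->; by rewrite ?orbT.
  - by [].
  by move: px; rewrite /= last_cat.
move=> u; rewrite in_setD in_set => /andP[uc uS].
have := degS uS; have lec := wheel_free_le2 cc uc.
have /card_neighbors_cover le : neighbors e u \subset (S :\: [set v in c]) :|: [set v in c].
  apply/subsetP => w; rewrite inE => /(nS _ _ uS).
  rewrite in_setU in_setD in_set.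
  by case/or3P => [/eqP->|/eqP->|->]; rewrite ?xc ?yc ?orbT // andbT orNb.
move=> /leq_trans/(_ le)/leq_trans; rewrite -(leq_add2r 2); apply.
by rewrite leq_add2l.
Qed.

End Fragment.

(** * Boundaries of subsets of a minimal fragment *)

Definition fragment S x y := [/\ S != set0, {in S, forall v, 4 <= degree e v},
  boundary S \subset [set x; y], x \notin S &
  x != y /\ connect (induced_rel (~: S)) x y].

Section MinimalFragment.

Variables (S : {set T}) (x y : T).
Hypothesis fragS : fragment S x y.
Hypothesis minS : forall (S' : {set T}) x' y', fragment S' x' y' -> #|S| <= #|S'|.

(** Pick [c] in [A] with a neighbour [b'], where [b'] is [b] if some vertex of [A] sees [b].
    Removing both from [A] gives a smaller fragment, with the adjacent vertices [b'] and [c] as its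
    pair. *)
Lemma minimal_fragment_boundary1 A b :
  A != set0 -> A \subset S -> ~ boundary A \subset [set b].
Proof.
have [_ degS _ _ _] := fragS => A0 AS bA.
have AP v w : v \in A -> e v w -> w \in A \/ w = b.
  move=> vA vw; have [|wA] := boolP (w \in A); [by left | right].
  by apply/set1P/(subsetP bA)/boundaryP; split=> //; exists v.
have [b' [c [cA cb' bA' cP]]] : exists b' (c : T), [/\ c \in A, e c b',
    boundary A \subset [set b'] & forall w, e c w -> w \in A \/ w = b'].
  have [[c [cA cb]]|nob] := classic (exists c : T, c \in A /\ e c b).
    by exists b, c; split=> // w; apply: AP.
  have inA v w : v \in A -> e v w -> w \in A.
    by move=> vA vw; case: (AP v w vA vw) => // wb; case: nob; exists v; rewrite -wb.
  have [c cA] := set0Pn _ A0; have := degS _ (subsetP AS c cA).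
  move=> /(leq_trans (isT : 0 < 4)) /card_gt0P[b']; rewrite inE => cb'.
  exists b', c; split=> //; last by move=> w /(inA _ _ cA); left.
  by apply/subsetP => v /boundaryP[/negP vA [w /inA wA /wA]].
have cb'N : c != b' by apply: contraTneq cb' => ->; rewrite e_irr.
have sub : A :\: [set b'; c] \subset S by apply: subset_trans AS; apply: subsetDl.
have /minS : fragment (A :\: [set b'; c]) b' c.
  split.
  - have /card_gt1P[w1 [w2 [+ + w12]]] : 2 <= #|neighbors e c|.
      by apply: leq_trans (degS _ (subsetP AS c cA)).
    rewrite !inE => cw1 cw2.
    have [w cw wb'] : exists2 w, e c w & w != b'.
      have [w1b|w1b] := eqVneq w1 b'; last by exists w1.
      by exists w2; rewrite // -w1b eq_sym.
    apply/set0Pn; exists w; rewrite !inE negb_or wb' /=.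
    case: (cP w cw) => [->|wE]; last by rewrite wE eqxx in wb'.
    by rewrite andbT; apply: contraTneq cw => ->; rewrite e_irr.
  - by move=> v /(subsetP sub); apply: degS.
  - apply/subsetP => v /boundaryP[+ [w /setDP[wA _] wv]].
    rewrite in_setD negb_and negbK => /orP[//|vA].
    rewrite in_set2; apply/orP; left; rewrite -in_set1; apply: (subsetP bA').
    by apply/boundaryP; split=> //; exists w.
  - by rewrite !inE eqxx.
  split; first by rewrite eq_sym.
  by apply: connect_edge; rewrite ?inE ?eqxx ?orbT // e_sym.
rewrite leqNgt => /negP[]; apply: proper_card; apply/properP; split=> //.
by exists c; [apply: (subsetP AS) | rewrite !inE eqxx orbT].
Qed.

(** Suppose the boundary is a pair [a], [b]. If these are joined outside [A], then [A] is a smaller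
    fragment. Otherwise one of them, say [a], is joined to neither [x] nor [y] outside [A]; its
    component there stays in [S], and adding it to [A] leaves at most [b] on the boundary. *)
Lemma minimal_fragment_boundary3 A :
  A != set0 -> A \proper S -> 3 <= #|boundary A|.
Proof.
have [_ degS bS xS [xy cxy]] := fragS => A0 pAS; have AS := proper_sub pAS.
have yS : y \notin S.
  by have := connect_induced_mem _ cxy; rewrite !inE; apply.
rewrite leqNgt; apply/negP => le2.
have [a [b [ab bA]]] : exists a b, a != b /\ boundary A = [set a; b].
  apply/cards2P; rewrite eqn_leq -ltnS le2 ltnNge; apply/negP => le1.
  have [bA0|[b bb]] := set_0Vmem (boundary A).
    by apply: (@minimal_fragment_boundary1 A x) => //; rewrite bA0 sub0set.
  apply: (@minimal_fragment_boundary1 A b) => //; apply/subsetP => v vb.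
  by rewrite inE; apply/eqP/(card_le1_eqP le1).
have cAxy : connect (induced_rel (~: A)) x y.
  by apply: connect_induced_sub cxy; rewrite setCS.
have no_ab : ~ connect (induced_rel (~: A)) a b.
  move=> cab; have /minS : fragment A a b.
    split=> //; first by move=> v /(subsetP AS); apply: degS.
      by rewrite bA.
    by have : a \in boundary A by [rewrite bA !inE eqxx]; case/boundaryP.
  by rewrite leqNgt => /negP[]; apply: proper_card.
(* If [a] and [b] were both joined to [x] outside [A], they would be joined to each other. *)
wlog no_ax : a b ab bA no_ab / ~ connect (induced_rel (~: A)) a x.
  move=> IH; apply: (IH a b) => // cax; apply: (IH b a) => //.
  - by rewrite eq_sym.
  - by rewrite setUC.
  - by rewrite induced_sym.
  by move=> cbx; apply: no_ab; apply: connect_trans cax _; rewrite induced_sym.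
have no_ay : ~ connect (induced_rel (~: A)) a y.
  by move=> cay; apply: no_ax; apply: connect_trans cay _; rewrite induced_sym.
have [aA [v0 v0A v0a]] : a \notin A /\ exists2 v, v \in A & e v a.
  by apply/boundaryP; rewrite bA !inE eqxx.
pose W := [set w | connect (induced_rel (~: A)) a w].
have stayS v w : v \in S -> e v w -> connect (induced_rel (~: A)) a w -> w \in S.
  move=> vS vw aw; apply/contraT => wS.
  have : w \in boundary S by apply/boundaryP; split=> //; exists v.
  by move/(subsetP bS); rewrite !inE => /orP[]/eqP wE; rewrite wE in aw.
have aS : a \in S by apply: stayS (subsetP AS _ v0A) v0a (connect0 _ _).
have WS : W \subset S.
  apply/subsetP => w; rewrite inE => aw.
  suff [] : connect (induced_rel (~: A)) a w /\ w \in S by [].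
  apply: (connect_closed (P := fun w => connect _ a w /\ w \in S)) aw => //.
  move=> u v [au uS] uv; have av := connect_trans au (connect1 uv).
  by split=> //; apply: stayS uS _ av; case/and3P: uv.
have AW0 : A :|: W != set0 by rewrite setU_eq0 negb_and A0.
have AWS : A :|: W \subset S by rewrite subUset AS.
apply: (minimal_fragment_boundary1 AW0 AWS (b := b)).
apply/subsetP => v /boundaryP[]; rewrite in_setU negb_or => /andP[vA vW] [w].
rewrite in_setU => /orP[wA|wW] wv.
  have : v \in boundary A by apply/boundaryP; split=> //; exists w.
  rewrite bA => /set2P[va|->]; last exact: set11.
  by rewrite va inE connect0 in vW.
have aw : connect (induced_rel (~: A)) a w by move: wW; rewrite inE.
have wA : w \in ~: A by apply: connect_induced_mem aw; rewrite inE.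
have vcA : v \in ~: A by rewrite inE.
by move: vW; rewrite in_set (connect_trans aw (connect_edge wA vcA wv)).
Qed.

End MinimalFragment.

Lemma no_fragment S x y : ~ fragment S x y.
Proof.
move=> fragS; pose P p := fragment p.1.1 p.1.2 p.2.
have [|[[S' x'] y'] /= fragS' minS'] := @ex_minimal _ P (fun p => #|p.1.1|).
  by exists (S, x, y).
have {}minS' S2 x2 y2 : fragment S2 x2 y2 -> #|S'| <= #|S2|.
  exact: (minS' (S2, x2, y2)).
have [S0 degS bS xS [xy cxy]] := fragS'.
exact: (fragment_wheel degS bS (minimal_fragment_boundary3 fragS' minS')).
Qed.

End Graph.

(** * A fragment from a shortage of low-degree vertices *)

Theorem theorem4p7 (T : finType) (e : rel T)
    (e_sym : symmetric e) (e_irr : irreflexive e)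
    (e_wheel_free : wheel_free e) (T_ge2 : 2 <= #|T|) :
  2 <= #|[set v : T | degree e v <= 3]|.
Proof.
set low := [set v | _]; rewrite leqNgt; apply/negP; rewrite ltnS => low1.
have high v w : v \in low -> w != v -> 4 <= degree e w.
  move=> vlow; apply: contraNT; rewrite -leqNgt => wlow.
  by apply/eqP/(card_le1_eqP low1) => //; rewrite inE.
(* If a low vertex has a neighbour, it is taken as [w]; otherwise all low vertices are isolated and
   any edge at a vertex outside [low] will do. *)
have [w [y [wy yhigh isolated]]] : exists w y, [/\ e w y, 4 <= degree e y &
    forall v, v \in low -> v != w -> forall u, ~~ e v u].
  have [[z [y [zlow zy]]]|isol] := classic (exists z y, z \in low /\ e z y).
    exists z, y; split=> //.
      by apply: high zlow _; apply: contraTneq zy => ->; rewrite e_irr.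
    by move=> v vlow; rewrite (card_le1_eqP low1 _ _ zlow vlow) eqxx.
  have nolow v u : v \in low -> ~~ e v u.
    by move=> vlow; apply/negP => vu; apply: isol; exists v, u.
  have [w wlow] : exists w, w \notin low.
    apply: NNPP => nw; have : #|T| <= #|low|.
      by apply: subset_leq_card; apply/subsetP => v _; apply/contraT => vl; case: nw; exists v.
    by move/(leq_trans T_ge2); rewrite ltnNge low1.
  have wdeg : 4 <= degree e w by rewrite inE -ltnNge in wlow.
  have /card_gt0P[y] : 0 < degree e w by apply: leq_trans wdeg.
  rewrite inE => wy; exists w, y; split=> //; last by move=> v /nolow.
  rewrite ltnNge; apply/negP => ylow.
  by have := nolow y w; rewrite inE ylow e_sym wy => /(_ isT).
(* Low vertices other than [w] are isolated, so the boundary of this set lies in the adjacent pair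
   [w], [y]. *)
apply: (@no_fragment _ _ e_sym e_irr e_wheel_free (~: (w |: (y |: low))) w y).
have yw : y != w by apply: contraTneq wy => ->; rewrite e_irr.
split.
- have [u yu] : exists2 u, u \in neighbors e y & u != w.
    have /card_gt1P[u1 [u2 [u1y u2y u12]]] : 2 <= degree e y by apply: leq_trans yhigh.
    have [u1w|u1w] := eqVneq u1 w; last by exists u1.
    by exists u2; rewrite // -u1w eq_sym.
  move=> uw; rewrite inE in yu; apply/set0Pn; exists u; rewrite !in_setC !in_setU1 !negb_or uw.
  apply/and3P; split=> //; first by apply: contraTneq yu => ->; rewrite e_irr.
  apply/negP => ulow; have := isolated _ ulow uw y.
  by rewrite e_sym yu.
- move=> v; rewrite !in_setC !in_setU1 !negb_or => /and3P[_ _].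
  by rewrite inE -ltnNge.
- apply/subsetP => v /boundaryP[]; rewrite in_setC negbK => vS [u _ uv].
  rewrite in_set2; move: vS; rewrite !in_setU1; case: eqP => //= /eqP vw.
  case: eqP => //= _ vlow; have := isolated _ vlow vw u.
  by rewrite e_sym uv.
- by rewrite in_setC setU11.
split; first by rewrite eq_sym.
by apply: connect_edge => //; rewrite setCK !in_setU1 eqxx ?orbT.
Qed.
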